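(* Let $n\geq 1$ and let $\mathcal{N}:L_n([0,1])\to L_n([0,1])$ be an $n$-dimensional strong fuzzy negation. Then for each $\mathbf{x}\in L_n([0,1])$ with $\mathbf{x}\notin\mathcal{D}_n$, one has $\mathcal{N}(\mathbf{x})\notin\mathcal{D}_n$.
   Context: $L_n([0,1])=\{(x_1,\ldots,x_n)\in[0,1]^n : x_1\leq\cdots\leq x_n\}$ with the componentwise order. For $x\in[0,1]$, $/x/=(x,\ldots,x)$; $\mathcal{D}_n=\{/x/ : x\in[0,1]\}$ is the set of degenerate elements. An $n$-dimensional fuzzy negation is a function $\mathcal{N}:L_n([0,1])\to L_n([0,1])$ with $\mathcal{N}(/0/)=/1/$, $\mathcal{N}(/1/)=/0/$ and $\mathcal{N}(\mathbf{x})\geq\mathcal{N}(\mathbf{y})$ whenever $\mathbf{x}\leq\mathbf{y}$. It is strong if $\mathcal{N}(\mathcal{N}(\mathbf{x}))=\mathbf{x}$ for all $\mathbf{x}\in L_n([0,1])$. *)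

(* Defs.v *)
From HB Require Import structures.
From mathcomp Require Import all_boot all_order all_algebra.
From mathcomp Require Import classical_sets reals interval_inference.

Set Implicit Arguments.
Unset Strict Implicit.
Unset Printing Implicit Defensive.

Import Order.TTheory GRing.Theory Num.Theory.
Local Open Scope ring_scope.
Local Open Scope classical_set_scope.

(* L_n([0,1]), with [0,1] = {i01 R}. The underlying tuples carry the product
   order, so the order inherited below is the componentwise one (simplex_leP). *)
Record simplex (R : realType) (n : nat) := Simplex {
  simplex_val : n.-tupleprod[ring_display] {i01 R};
  simplex_sorted : sorted <=%O (simplex_val : seq {i01 R})
}.

Coercion simplex_tuple (R : realType) (n : nat) (x : simplex R n) :
  n.-tuple {i01 R} := simplex_val x.

HB.instance Definition _ (R : realType) (n : nat) :=
  [isSub for @simplex_val R n].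
HB.instance Definition _ (R : realType) (n : nat) :=
  [Choice of simplex R n by <:].
HB.instance Definition _ (R : realType) (n : nat) :=
  [SubChoice_isSubPOrder of simplex R n by <: with ring_display].

Lemma simplex_leP (R : realType) (n : nat) (x y : simplex R n) :
  reflect (forall i : 'I_n, (tnth x i)%:num <= (tnth y i)%:num) (x <= y).
Proof. by rewrite -Order.le_val leEtprod; apply: forallP. Qed.

Lemma simplex_sortedP (R : realType) (n : nat)
    (t : n.-tupleprod[ring_display] {i01 R}) :
  reflect (forall i j : 'I_n, (i <= j)%N -> (tnth t i)%:num <= (tnth t j)%:num)
          (sorted <=%O (t : seq {i01 R})).
Proof.
apply: (iffP idP) => [st i j le_ij|mono_t].
  rewrite (tnth_nth 0%:i01) (tnth_nth 0%:i01 t j).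
  by apply: (sorted_leq_nth le_trans lexx 0%:i01 st); rewrite ?inE ?size_tuple.
apply/(sortedP 0%:i01) => i; rewrite size_tuple => lt_in.
have := mono_t (Ordinal (ltnW lt_in)) (Ordinal lt_in) (leqnSn i).
by rewrite (tnth_nth 0%:i01) (tnth_nth 0%:i01 t (Ordinal lt_in)).
Qed.

Lemma nseq_sorted (R : realType) (n : nat) (a : {i01 R}) :
  sorted <=%O (nseq_tuple n a : seq {i01 R}).
Proof.
by apply/(sortedP a) => i; rewrite size_nseq => lt_in; rewrite !nth_nseq !if_same.
Qed.

(* /a/ = (a, ..., a) *)
Definition diag (R : realType) (n : nat) (a : {i01 R}) : simplex R n :=
  Simplex (nseq_sorted n a : sorted _ (nseq_tuple n a : n.-tupleprod[ring_display] _)).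

Definition degenerate (R : realType) (n : nat) : set (simplex R n) :=
  range (@diag R n).

Record fuzzy_negation (R : realType) (n : nat)
    (N : simplex R n -> simplex R n) : Prop := FuzzyNegation {
  fuzzy_negation0 : N (diag n 0%:i01) = diag n 1%:i01;
  fuzzy_negation1 : N (diag n 1%:i01) = diag n 0%:i01;
  fuzzy_negation_anti : forall x y : simplex R n, x <= y -> N y <= N x
}.

Record strong_fuzzy_negation (R : realType) (n : nat)
    (N : simplex R n -> simplex R n) : Prop := StrongFuzzyNegation {
  strong_fuzzy_negation_base : fuzzy_negation N;
  strong_fuzzy_negationK : involutive N
}.

(* Main.v *)
(** The map [N] is an anti-automorphism of the order, so it preserves the self-dual
    property that the elements strictly below [x] are up-directed and those
    strictly above [x] are down-directed.  Degenerate elements have it, and a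
    nondegenerate element having it is [{0,1}]-valued, starts with 0 and ends
    with 1.  Suppose [x] is nondegenerate and [N x = /a/].  Then [x = N /a/] is of
    this form, so it is incomparable with every [/c/], [0 < c < 1]; hence [N /c/]
    is incomparable with [/a/], so it is nondegenerate and therefore
    [{0,1}]-valued.  This embeds the infinite chain of such [/c/] into the finite
    set of [{0,1}]-valued elements. *)
Require Import Defs.
From mathcomp Require Import all_boot all_order all_algebra.
From mathcomp Require Import classical_sets reals interval_inference.

Set Implicit Arguments.
Unset Strict Implicit.
Unset Printing Implicit Defensive.

Import Order.TTheory GRing.Theory Num.Theory.
Local Open Scope ring_scope.

(** * Order on the unit interval and on sorted tuples *)

Lemma i01_ge0 (R : realType) (a : {i01 R}) : 0%:i01 <= a.
Proof. exact: (ge0 a). Qed.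

Lemma i01_le1 (R : realType) (a : {i01 R}) : a <= 1%:i01.
Proof. exact: (le1 a). Qed.

Lemma i01_dense (R : realType) (a b : {i01 R}) :
  a < b -> exists c : {i01 R}, a < c < b.
Proof.
move=> lt_ab; have [lt_am lt_mb] := midf_lt (lt_ab : a%:num < b%:num).
have m_ge0 : 0 <= (a%:num + b%:num) / 2 by rewrite (le_trans (ge0 a)) ?ltW.
have m_le1 : (a%:num + b%:num) / 2 <= 1 by rewrite (le_trans (ltW lt_mb)) ?le1.
by exists (Itv01 m_ge0 m_le1); apply/andP; split.
Qed.

Section Simplex.
Variables (R : realType) (n : nat).
Implicit Types (x y : simplex R n) (a b : {i01 R}).

Lemma simplex_leE x y : (x <= y) = [forall i, tnth x i <= tnth y i].
Proof. by rewrite -Order.le_val leEtprod. Qed.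

Lemma simplex_le_tnth x y : x <= y -> forall i, tnth x i <= tnth y i.
Proof. by rewrite simplex_leE => /forallP. Qed.

Lemma le_simplex x y : (forall i, tnth x i <= tnth y i) -> x <= y.
Proof. by move=> le_xy; rewrite simplex_leE; apply/forallP. Qed.

Lemma simplex_ltP x y :
  reflect (x <= y /\ exists i, tnth x i < tnth y i) (x < y).
Proof.
rewrite lt_leAnge; apply: (iffP andP) => -[le_xy].
  rewrite simplex_leE => /forallPn[i]; rewrite -ltNge => lt_i.
  by split=> //; exists i.
case=> i lt_i; split=> //; apply/negP => /simplex_le_tnth/(_ i).
by rewrite leNgt lt_i.
Qed.

Lemma tnth_simplex_le x (i j : 'I_n) : (i <= j)%N -> tnth x i <= tnth x j.
Proof. exact: (elimT (simplex_sortedP _) (simplex_sorted x)). Qed.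

Lemma tnth_diag a i : tnth (diag n a) i = a.
Proof. by rewrite tnth_nseq. Qed.

Lemma diag_le a b : a <= b -> diag n a <= diag n b.
Proof. by move=> le_ab; apply: le_simplex => i; rewrite !tnth_diag. Qed.

Lemma mono_simplex (f : 'I_n -> {i01 R}) :
    (forall i j : 'I_n, (i <= j)%N -> f i <= f j) ->
  exists x, forall i, tnth x i = f i.
Proof.
move=> f_mono.
have st : sorted <=%O ([tuple f i | i < n] : seq {i01 R}).
  by apply/simplex_sortedP => i j /f_mono; rewrite !tnth_mktuple.
by exists (Simplex (st : sorted _ ([tuple f i | i < n]
  : n.-tupleprod[ring_display] _))) => i; rewrite tnth_mktuple.
Qed.

Lemma map_simplex (f : {i01 R} -> {i01 R}) x :
    (forall a b, a <= b -> f a <= f b) ->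
  exists y, forall i, tnth y i = f (tnth x i).
Proof. by move=> fm; apply: mono_simplex => i j /(tnth_simplex_le x)/fm. Qed.

(** * Directedness and the coordinate values it forces *)

Definition strict_lower_directed x : Prop :=
  forall y z, y < x -> z < x -> exists u, [/\ u < x, y <= u & z <= u].

Definition strict_upper_directed x : Prop :=
  forall y z, x < y -> x < z -> exists u, [/\ x < u, u <= y & u <= z].

(** Were the entry [tnth x i] positive, capping [x] at that value ([y]) and sending all entries up
    to that value to 0 ([z]) would give two elements strictly below [x]. At each coordinate one of
    them agrees with [x], so no common upper bound stays strictly below [x]. *)
Lemma lower_directed_eq0 x i j :
  strict_lower_directed x -> tnth x i < tnth x j -> tnth x i = 0%:i01.
Proof.
move=> xP lt_ij; apply/eqP; rewrite eq_le i01_ge0 andbT leNgt; apply/negP => xi_gt0.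
have [|y yE] := @map_simplex (Order.min (tnth x i)) x.
  by move=> a b le_ab; rewrite le_min !ge_min lexx le_ab orbT.
have [|z zE] := @map_simplex (fun t => if t <= tnth x i then 0%:i01 else t) x.
  move=> a b le_ab; case: ifP => [_|/negbT a_gt]; first by rewrite i01_ge0.
  by rewrite ifN // -ltNge (lt_le_trans _ le_ab) // ltNge.
have [||u [/simplex_ltP[le_ux [k lt_k]] le_yu le_zu]] := xP y z.
- apply/simplex_ltP; split; last by exists j; rewrite yE gt_min lt_ij.
  by apply: le_simplex => k; rewrite yE ge_min lexx orbT.
- apply/simplex_ltP; split; last by exists i; rewrite zE lexx.
  by apply: le_simplex => k; rewrite zE; case: ifP => // _; rewrite i01_ge0.
move: (simplex_le_tnth le_yu k) (simplex_le_tnth le_zu k); rewrite yE zE.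
case: (leP (tnth x k) (tnth x i)) => [le_ki|_ _]; last by rewrite leNgt lt_k.
by rewrite leNgt lt_k.
Qed.

(** Dual argument: [y] raises all entries to at least [tnth x j], [z] sends the entries from that
    value on to 1, and their pointwise minimum is [x]. *)
Lemma upper_directed_eq1 x i j :
  strict_upper_directed x -> tnth x i < tnth x j -> tnth x j = 1%:i01.
Proof.
move=> xP lt_ij; apply/eqP; rewrite eq_le i01_le1 /= leNgt; apply/negP => xj_lt1.
have [|y yE] := @map_simplex (Order.max (tnth x j)) x.
  by move=> a b le_ab; rewrite ge_max !le_max lexx le_ab orbT.
have [|z zE] := @map_simplex (fun t => if tnth x j <= t then 1%:i01 else t) x.
  move=> a b le_ab; case: (leP _ b) => [_|b_lt]; first by case: ifP; rewrite i01_le1.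
  by rewrite ifN // -ltNge (le_lt_trans le_ab).
have [||u [/simplex_ltP[le_xu [k lt_k]] le_uy le_uz]] := xP y z.
- apply/simplex_ltP; split; last by exists i; rewrite yE lt_max lt_ij.
  by apply: le_simplex => k; rewrite yE le_max lexx orbT.
- apply/simplex_ltP; split; last by exists j; rewrite zE lexx.
  by apply: le_simplex => k; rewrite zE; case: ifP => // _; rewrite i01_le1.
move: (simplex_le_tnth le_uy k) (simplex_le_tnth le_uz k); rewrite yE zE.
by case: (leP (tnth x j) (tnth x k)) => [_|_ _]; rewrite leNgt lt_k.
Qed.

End Simplex.

(** * Degenerate elements and zero-one valued elements *)

Section Degenerate.
Variables (R : realType) (n : nat).
Implicit Types (x y : simplex R n.+1) (a b : {i01 R}).

Lemma diag_le_iff a b : (diag n.+1 a <= diag n.+1 b) = (a <= b).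
Proof.
apply/idP/idP => [/simplex_le_tnth/(_ ord0)|]; last exact: diag_le.
by rewrite !tnth_diag.
Qed.

(** By sortedness, an element below [/a/] is strictly below it exactly when its first entry is less
    than [a]. Hence [(m, a, ..., a)], with [m] the larger of the two first entries, is the required
    bound. *)
Lemma diag_lower_directed a : strict_lower_directed (diag n.+1 a).
Proof.
have lt_first y : y < diag n.+1 a -> tnth y ord0 < a.
  move=> /simplex_ltP[_ [i]]; rewrite tnth_diag; apply: le_lt_trans.
  exact: tnth_simplex_le.
have le_a y i : y < diag n.+1 a -> tnth y i <= a.
  by move=> /ltW/simplex_le_tnth/(_ i); rewrite tnth_diag.
move=> y z lt_y lt_z.
pose m := Order.max (tnth y ord0) (tnth z ord0).
have lt_m : m < a by rewrite gt_max !lt_first.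
have [|u uE] := @mono_simplex R n.+1 (fun i => if i == ord0 then m else a).
  move=> i j le_ij; have [_|i_neq0] := eqVneq i; first by case: ifP => // _; apply: ltW.
  by rewrite ifN //; apply: contraNneq i_neq0 => j0; move: le_ij; rewrite j0 leqn0.
exists u; split.
- apply/simplex_ltP; split; last by exists ord0; rewrite tnth_diag uE.
  by apply: le_simplex => i; rewrite tnth_diag uE; case: ifP => // _; apply: ltW.
- apply: le_simplex => i; rewrite uE; case: eqP => [->|_]; last exact: le_a.
  by rewrite le_max lexx.
- apply: le_simplex => i; rewrite uE; case: eqP => [->|_]; last exact: le_a.
  by rewrite le_max lexx orbT.
Qed.

(** Dually, strictness above [/a/] is visible in the last entry, and [(a, ..., a, m)] works with [m]
    the smaller of the two last entries. *)
Lemma diag_upper_directed a : strict_upper_directed (diag n.+1 a).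
Proof.
have gt_last y : diag n.+1 a < y -> a < tnth y ord_max.
  move=> /simplex_ltP[_ [i]]; rewrite tnth_diag => /lt_le_trans; apply.
  by apply: tnth_simplex_le; rewrite -ltnS.
have ge_a y i : diag n.+1 a < y -> a <= tnth y i.
  by move=> /ltW/simplex_le_tnth/(_ i); rewrite tnth_diag.
move=> y z lt_y lt_z.
pose m := Order.min (tnth y ord_max) (tnth z ord_max).
have lt_m : a < m by rewrite lt_min !gt_last.
have [|u uE] := @mono_simplex R n.+1 (fun i => if i == ord_max then m else a).
  move=> i j le_ij; have [_|j_neq] := eqVneq j; first by case: ifP => // _; apply: ltW.
  rewrite ifN //; apply: contraNneq j_neq => i_max; apply/eqP/val_inj/anti_leq.
  by rewrite -{2}i_max le_ij -ltnS ltn_ord.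
exists u; split.
- apply/simplex_ltP; split; last by exists ord_max; rewrite tnth_diag uE eqxx.
  by apply: le_simplex => i; rewrite tnth_diag uE; case: ifP => // _; apply: ltW.
- apply: le_simplex => i; rewrite uE; case: eqP => [->|_]; last exact: ge_a.
  by rewrite ge_min lexx.
- apply: le_simplex => i; rewrite uE; case: eqP => [->|_]; last exact: ge_a.
  by rewrite ge_min lexx orbT.
Qed.

Lemma nondegenerate_lt x :
  ~ degenerate x -> exists i, tnth x ord0 < tnth x i.
Proof.
move=> xnd; apply/existsP; apply: contra_notT xnd => /existsPn x_le.
exists (tnth x ord0) => //; apply: le_anti; apply/andP; split.
  by apply: le_simplex => i; rewrite tnth_diag tnth_simplex_le.
by apply: le_simplex => i; rewrite tnth_diag leNgt x_le.
Qed.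

Definition zero_one_valued x : Prop :=
  forall i, tnth x i = 0%:i01 \/ tnth x i = 1%:i01.

(** Some entry exceeds the first one, which forces the first to be 0; every other entry either does
    not exceed it, hence is 0, or exceeds it, hence is 1. *)
Lemma directed_nondegenerate01 x :
    strict_lower_directed x -> strict_upper_directed x -> ~ degenerate x ->
  [/\ tnth x ord0 = 0%:i01, exists i, tnth x i = 1%:i01 &
      zero_one_valued x].
Proof.
move=> xl xu /nondegenerate_lt[j lt_j].
have x0 := lower_directed_eq0 xl lt_j.
split=> [//||i]; first by exists j; apply: upper_directed_eq1 lt_j.
have [le_i|lt_i] := leP (tnth x i) (tnth x ord0).
  by left; apply: le_anti; rewrite i01_ge0 -{1}x0 le_i.
by right; apply: upper_directed_eq1 lt_i.
Qed.

Definition ones x : {set 'I_n.+1} := [set i | tnth x i == 1%:i01].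

(** Where [x] is strictly smaller, [y] is nonzero, hence 1, while [x] is not 1. Strict chains of
    zero-one valued elements thus become strict chains of finite sets. *)
Lemma ones_proper x y :
  zero_one_valued y -> x < y -> ones x \proper ones y.
Proof.
move=> y01 /simplex_ltP[/simplex_le_tnth le_xy [i lt_i]].
apply/properP; split; last first.
  exists i; rewrite inE.
    case: (y01 i) => [y0|->//].
    by move: lt_i; rewrite y0 ltNge i01_ge0.
  by rewrite lt_eqF // (lt_le_trans lt_i) // i01_le1.
apply/fintype.subsetP => j; rewrite !inE => /eqP xj.
by rewrite eq_le i01_le1 -xj le_xy.
Qed.

End Degenerate.

(** * Strong negations as anti-automorphisms of the order *)

Section StrongNegation.
Variables (R : realType) (n : nat) (N : simplex R n -> simplex R n).
Hypothesis N_strong : strong_fuzzy_negation N.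

Let NK : involutive N := strong_fuzzy_negationK N_strong.

Lemma strong_negation_leC x y : (N x <= y) = (N y <= x).
Proof.
have anti := fuzzy_negation_anti (strong_fuzzy_negation_base N_strong).
by apply/idP/idP => /anti; rewrite NK.
Qed.

Lemma strong_negation_le x y : (N x <= N y) = (y <= x).
Proof. by rewrite strong_negation_leC NK. Qed.

Lemma strong_negation_lt x y : (N x < N y) = (y < x).
Proof. by rewrite !lt_leAnge !strong_negation_le. Qed.

Lemma strong_negation_lower_directed x :
  strict_upper_directed x -> strict_lower_directed (N x).
Proof.
move=> xP y z; rewrite -[y]NK -[z]NK !strong_negation_lt => lt_y lt_z.
have [u [lt_u le_y le_z]] := xP _ _ lt_y lt_z.
by exists (N u); rewrite strong_negation_lt !strong_negation_le.
Qed.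

Lemma strong_negation_upper_directed x :
  strict_lower_directed x -> strict_upper_directed (N x).
Proof.
move=> xP y z; rewrite -[y]NK -[z]NK !strong_negation_lt => lt_y lt_z.
have [u [lt_u le_y le_z]] := xP _ _ lt_y lt_z.
by exists (N u); rewrite strong_negation_lt !strong_negation_le.
Qed.

End StrongNegation.

Theorem theorem21 (R : realType) (n : nat) (n_ge1 : (1 <= n)%N)
    (N : simplex R n -> simplex R n) (N_strong : strong_fuzzy_negation N)
    (x : simplex R n) (x_nondegenerate : ~ degenerate x) :
  ~ degenerate (N x).
Proof.
case: n n_ge1 N N_strong x x_nondegenerate => // n _ N N_strong x xnd [a _ Nx].
have NK := strong_fuzzy_negationK N_strong.
have Na : N (diag n.+1 a) = x by rewrite Nx NK.
have N_diag01 c : ~ degenerate (N (diag n.+1 c)) ->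
  [/\ tnth (N (diag n.+1 c)) ord0 = 0%:i01,
      exists i, tnth (N (diag n.+1 c)) i = 1%:i01 &
      zero_one_valued (N (diag n.+1 c))].
  apply: directed_nondegenerate01.
    exact: strong_negation_lower_directed N_strong _ (@diag_upper_directed _ _ _).
  exact: strong_negation_upper_directed N_strong _ (@diag_lower_directed _ _ _).
have := N_diag01 a; rewrite Na => /(_ xnd)[x0 [k xk] _].
(* If [N /c/] were [/b/], then, [a] and [b] being comparable, so would be [/c/] and [x]. But
   [/c/ <= x] fails at [ord0], where [x] is 0, and [x <= /c/] fails at [k], where [x] is 1. *)
have N_nondeg c : 0%:i01 < c < 1%:i01 -> ~ degenerate (N (diag n.+1 c)).
  move=> /andP[c_gt0 c_lt1] [b _ Nc].
  have [le_ab|/ltW le_ba] := leP a b.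
    have := diag_le n.+1 le_ab; rewrite Nc Nx (strong_negation_le N_strong).
    by move=> /simplex_le_tnth/(_ ord0); rewrite tnth_diag x0 leNgt c_gt0.
  have := diag_le n.+1 le_ba; rewrite Nc Nx (strong_negation_le N_strong).
  by move=> /simplex_le_tnth/(_ k); rewrite tnth_diag xk leNgt c_lt1.
(* Choosing [d] strictly between [c] and 1 gives [N /d/ < N /c/], so [N /c/] has at least one more
   entry 1 than [N /d/]. Quantifying over [c] lets the induction on [m] move on to [d]. *)
have many_ones m c : 0%:i01 < c < 1%:i01 ->
    (m <= #|ones (N (diag n.+1 c))|)%N.
  elim: m c => // m IHm c c01; have /andP[c_gt0 c_lt1] := c01.
  have [d /andP[lt_cd d_lt1]] := i01_dense c_lt1.
  have d01 : 0%:i01 < d < 1%:i01 by rewrite (lt_trans c_gt0 lt_cd).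
  apply: leq_ltn_trans (IHm d d01) _.
  have [_ _ Nc01] := N_diag01 _ (N_nondeg _ c01).
  apply/proper_card/ones_proper => //; rewrite (strong_negation_lt N_strong).
  by rewrite lt_leAnge !diag_le_iff (ltW lt_cd) leNgt lt_cd.
have [c c01] := i01_dense (ltr01 : (0%:i01 : {i01 R}) < 1%:i01).
(* There are only [n.+1] coordinates, so [n.+2] entries equal to 1 is impossible. *)
have := leq_trans (many_ones n.+2 c c01) (max_card _).
by rewrite card_ord ltnn.
Qed.
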